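(* Let $C=(c_{ij})_{i,j\in I}$ be a symmetrizable generalized Cartan matrix with finite index set $I$. Let $[a,b]$ be an integer interval ($a,b\in\mathbb Z\sqcup\{\pm\infty\}$), let $\mathbf i=(i_k)_{k\in[a,b]}$ be a sequence of elements of $I$, and let $\mathfrak C=(\mathfrak c_k)_{k}$ be a chain of $\mathbf i$-boxes of range $[a,b]$ such that $B(\underline{\mathbf h}(\mathfrak C))$ is locally finite. Then the Kashiwara--Kim matrix $B^{\mathrm{KK}}(\mathfrak C)$ is equal to the matrix $B(\underline{\mathbf h}(\mathfrak C))$ of the signed word $\underline{\mathbf h}(\mathfrak C)$ associated with $\mathfrak C$.
   Context: **Intervals and $\mathbf i$-boxes.** $[a,b]=\{k\in\mathbb Z: a\le k\le b\}$, of length $l=\max(b-a+1,0)\in\mathbb N\cup\{\infty\}$; the one-element interval is written $\{c\}$. Let $\mathbf i=(i_k)_{k\in[a,b]}$ be a sequence in $I$. For $s\in[a,b]$ put $s^+=\min(\{t\in[a,b]: s<t,\ i_t=i_s\}\cup\{\infty\})$, $s^-=\max(\{t\in[a,b]: s>t,\ i_t=i_s\}\cup\{-\infty\})$. For $j\in I$, $s(j)^\oplus=\min(\{t\in[a,b]: t\ge s,\ i_t=j\}\cup\{\infty\})$ and $s(j)^\ominus=\max(\{t\in[a,b]: t\le s,\ i_t=j\}\cup\{-\infty\})$ (with the minimum read as $-\infty$ if the set is unbounded below, and the maximum as $+\infty$ if it is unbounded above). A finite integer interval $[x,y]\subset[a,b]$ is an $\mathbf i$-box if $i_x=i_y$;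 its color is $i([x,y])=i_x=i_y$. For a finite interval $[x,y]\subset[a,b]$, put $[x,y\}=[x,y(i_x)^\ominus]$ and $\{x,y]=[x(i_y)^\oplus,y]$. **Chains.** A chain of $\mathbf i$-boxes of length $l$ is a sequence of $\mathbf i$-boxes $\mathfrak C=(\mathfrak c_k)_{1\le k<l+1}$ such that for every $1\le s<l+1$: (i) $[\widetilde a_s,\widetilde b_s]:=\bigcup_{1\le k\le s}\mathfrak c_k$ is an interval of length $s$; (ii) $\mathfrak c_s$ is the largest $\mathbf i$-box of color $i(\mathfrak c_s)$ contained in $[\widetilde a_s,\widetilde b_s]$. Its range is $\bigcup_k\mathfrak c_k$. A chain corresponds bijectively to a pair $(c,(E_k)_{1\le k<l})$ with $\mathfrak c_1=\{c\}$, $E_k=L$ if $[\widetilde a_{k+1},\widetilde b_{k+1}]=[\widetilde a_k-1,\widetilde b_k]$ and $E_k=R$ otherwise; conversely $\mathfrak c_k=[\widetilde a_{k-1}-1,\widetilde b_{k-1}\}$ if $E_{k-1}=L$ and $\mathfrak c_k=\{\widetilde a_{k-1},\widetilde b_{k-1}+1]$ if $E_{k-1}=R$. Write $\mathfrak c_k=[a_k,b_k]$ and let $h_k$ be the color of $\mathfrak c_k$. The effective end of $\mathfrak c_k$ is $b_k$ if $k=1$ or $E_{k-1}=R$, and $a_k$ if $k=1$ or $E_{k-1}=L$ (for $k=1$, $a_1=b_1$). ''$[x,y]\in\mathfrak C$'' means that $[x,y]$ is one of the boxes $\mathfrak c_k$. **Index sets.** $K=K(\mathfrak C)=\{1,\dots,l\}$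 (or $\mathbb N_{\ge1}$ if $l=\infty$); $K^{\mathrm{fr}}=\{s\in K:\mathfrak c_s=[a(i)^\oplus,b(i)^\ominus]\text{ for some }i\in I\}$; $K^{\mathrm{ex}}=K\setminus K^{\mathrm{fr}}$. For $k\in K$, $k[1]$ is the smallest $k'\in K$ with $k'>k$ and $h_{k'}=h_k$, or $+\infty$ if none exists. **Signed words.** A signed word is a sequence $\underline{\mathbf h}=(\varepsilon_kh_k)_{1\le k<l+1}$ with $\varepsilon_k\in\{\pm1\}$, $h_k\in I$ (sign and letter are both part of the data). $K=K(\underline{\mathbf h})=\{k\in\mathbb Z:1\le k<l+1\}$, $K^{\mathrm{ex}}=\{s\in K:\exists t\in K,\ t>s,\ h_t=h_s\}$, and $k[1]=\min(\{k'\in K:k'>k,\ h_{k'}=h_k\}\sqcup\{+\infty\})$. Define $\widetilde B(\underline{\mathbf h})=(\widetilde b_{jk})_{j,k\in K}$ by - $\widetilde b_{jk}=\varepsilon_k$ if $k=j[1]$; - $\widetilde b_{jk}=-\varepsilon_j$ if $j=k[1]$; - $\widetilde b_{jk}=\varepsilon_kc_{h_j,h_k}$ if $\varepsilon_{j[1]}=\varepsilon_k$ and $j<k<j[1]<k[1]$; - $\widetilde b_{jk}=\varepsilon_kc_{h_j,h_k}$ if $\varepsilon_k=-\varepsilon_{k[1]}$ and $j<k<k[1]<j[1]$; - $\widetilde b_{jk}=-\varepsilon_jc_{h_j,h_k}$ if $\varepsilon_{k[1]}=\varepsilon_j$ and $k<j<k[1]<j[1]$; - $\widetilde b_{jk}=-\varepsilon_jc_{h_j,h_k}$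 if $\varepsilon_j=-\varepsilon_{j[1]}$ and $k<j<j[1]<k[1]$; - $\widetilde b_{jk}=0$ otherwise. $B(\underline{\mathbf h})$ is the $K\times K^{\mathrm{ex}}$-submatrix. It is locally finite if each row and each column has finitely many nonzero entries (automatic if $l<\infty$). **Signed word of a chain.** $\underline{\mathbf h}(\mathfrak C)=(\varepsilon_kh_k)_k$, where $h_k$ is the color of $\mathfrak c_k$, $\varepsilon_1=1$, and for $k\ge2$, $\varepsilon_k=1$ if $E_{k-1}=L$, $\varepsilon_k=-1$ if $E_{k-1}=R$. The sets $K,K^{\mathrm{ex}}$ and the map $k\mapsto k[1]$ for $\mathfrak C$ and for $\underline{\mathbf h}(\mathfrak C)$ coincide. **Kashiwara--Kim matrix.** Let $(d_i)_{i\in I}$ be the positive integers forming the minimal symmetrizer of $C$, so $d_ic_{ij}=d_jc_{ji}$. $\widetilde B^{\mathrm{KK}}(\mathfrak C)=(b^{\mathrm{KK}}_{jk})_{j,k\in K}$ is the matrix satisfying $d_{h_j}b^{\mathrm{KK}}_{jk}=-d_{h_k}b^{\mathrm{KK}}_{kj}$ for all $j,k$, whose positive entries are exactly the following (so that entries $b^{\mathrm{KK}}_{jk}$ for which neither $(j,k)$ nor $(k,j)$ is in the list are $0$): - $b^{\mathrm{KK}}_{jk}=1$ if ($a_j=a_k$ and $b_k=b_j^-$) or ($b_j=b_k$ and $a_k=a_j^-$); - $b^{\mathrm{KK}}_{jk}=-c_{h_j,h_k}$ if $c_{h_j,h_k}<0$ and at least one of the following holds: - (a) $[a_j,b_j^+]\in\mathfrak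 C$, $a_j$ is the effective end of $[a_j,b_j]$, and $a_k^-<a_j<a_k\le b_k<b_j^+<b_k^+$; - (b) $[a_j,b_j^+]\in\mathfrak C$, $b_k$ is the effective end of $[a_k,b_k]$, and $a_k^-<a_j\le b_j<b_k<b_j^+<b_k^+$; - (c) $[a_k^-,b_k]\in\mathfrak C$, $b_k$ is the effective end of $[a_k,b_k]$, and $a_j^-<a_k^-<a_j\le b_j<b_k<b_j^+$; - (d) $[a_k^-,b_k]\in\mathfrak C$, $a_j$ is the effective end of $[a_j,b_j]$, and $a_j^-<a_k^-<a_j<a_k\le b_k<b_j^+$. $B^{\mathrm{KK}}(\mathfrak C)$ is the $K\times K^{\mathrm{ex}}$-submatrix of $\widetilde B^{\mathrm{KK}}(\mathfrak C)$. *)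

(* Defs.v *)
From HB Require Import structures.
From mathcomp Require Import all_boot all_order all_algebra.
From mathcomp Require Import all_classical constructive_ereal.

Set Implicit Arguments.
Unset Strict Implicit.
Unset Printing Implicit Defensive.

Import Order.TTheory GRing.Theory Num.Theory.

Local Open Scope classical_set_scope.
Local Open Scope ring_scope.

(* Elements of Z together with -oo and +oo are terms of type \bar int, with
   their usual total order; lengths in N together with oo are the nonnegative
   ones. *)

Definition Zitv (a b : \bar int) : set int :=
  [set k : int | (a <= k%:E)%E && (k%:E <= b)%E].

Section CartanMatrix.
Variable I : finType.
Implicit Types (C : I -> I -> int) (d : I -> int).

Definition generalized_cartan C : Prop :=
  [/\ forall i, C i i = 2,
      forall i j, i != j -> C i j <= 0 &
      forall i j, C i j = 0 <-> C j i = 0].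

Definition symmetrizer C d : Prop :=
  (forall i, 0 < d i) /\ (forall i j, d i * C i j = d j * C j i).

Definition symmetrizable_gcm C : Prop :=
  generalized_cartan C /\ exists d, symmetrizer C d.

(* The positive integral symmetrizers are obtained by choosing, on each
   indecomposable block of C, a positive multiple of a primitive one; hence
   there is a pointwise least one. *)
Definition minimal_symmetrizer C d : Prop :=
  symmetrizer C d /\ forall d', symmetrizer C d' -> forall i, d i <= d' i.

End CartanMatrix.

(* A sequence indexed by [a, b] is a total function on int of which only the
   values on Zitv a b are used. The minimum of the union of A with {+oo}, read
   as -oo if A is unbounded below, is the infimum of A in \bar int. *)
Section Occurrences.
Variables (I : finType) (a b : \bar int) (i : int -> I).

Definition next_occ (s : int) : \bar int :=
  infimum +oo%E (EFin @` [set t : int | [/\ Zitv a b t, s < t & i t = i s]]).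

Definition prev_occ (s : int) : \bar int :=
  supremum -oo%E (EFin @` [set t : int | [/\ Zitv a b t, t < s & i t = i s]]).

Definition oplus (s : \bar int) (j : I) : \bar int :=
  infimum +oo%E
    (EFin @` [set t : int | [/\ Zitv a b t, (s <= t%:E)%E & i t = j]]).

Definition ominus (s : \bar int) (j : I) : \bar int :=
  supremum -oo%E
    (EFin @` [set t : int | [/\ Zitv a b t, (t%:E <= s)%E & i t = j]]).

End Occurrences.

Definition box_set (c : int * int) : set int := Zitv c.1%:E c.2%:E.

Definition is_ibox (I : finType) (a b : \bar int) (i : int -> I)
    (c : int * int) : Prop :=
  [/\ c.1 <= c.2, box_set c `<=` Zitv a b & i c.1 = i c.2].

Definition boxes_upto (c : int -> int * int) (s : int) : set int :=
  \bigcup_(k in Zitv 1%:E s%:E) box_set (c k).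

Record ibox_chain (I : finType) (a b : \bar int) (i : int -> I) := IboxChain {
  chain_len : \bar int;
  chain_box : int -> int * int;
  chain_len_ge0 : (0 <= chain_len)%E;
  chain_ibox : forall s, Zitv 1%:E chain_len s -> is_ibox a b i (chain_box s);
  chain_interval : forall s, Zitv 1%:E chain_len s ->
    exists x y : int,
      boxes_upto chain_box s = Zitv x%:E y%:E /\ y - x + 1 = s;
  chain_largest : forall s, Zitv 1%:E chain_len s ->
    forall c, is_ibox a b i c -> i c.1 = i (chain_box s).1 ->
      box_set c `<=` boxes_upto chain_box s ->
      box_set c `<=` box_set (chain_box s) }.

Section Chain.
Variables (I : finType) (a b : \bar int) (i : int -> I).
Variable CC : ibox_chain a b i.

Definition chain_idx : set int := Zitv 1%:E (chain_len CC).

Definition chain_range : set int :=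
  \bigcup_(k in chain_idx) box_set (chain_box CC k).

Definition chain_left (k : int) : int := (chain_box CC k).1.
Definition chain_right (k : int) : int := (chain_box CC k).2.
Definition chain_color (k : int) : I := i (chain_left k).

(* E_k = L *)
Definition step_left (k : int) : Prop :=
  exists x y : int,
    [/\ x <= y, boxes_upto (chain_box CC) k = Zitv x%:E y%:E &
        boxes_upto (chain_box CC) (k + 1) = Zitv (x - 1)%:E y%:E].

(* Both ends of the first box coincide. *)
Definition effective_end (k : int) : int :=
  if (k == 1) || `[< step_left (k - 1) >] then chain_left k else chain_right k.

Definition chain_frozen : set int :=
  [set s | chain_idx s /\ exists j : I,
     (chain_left s)%:E = oplus a b i a j /\
     (chain_right s)%:E = ominus a b i b j].

Definition chain_ex : set int := chain_idx `\` chain_frozen.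

Definition in_chain (x y : \bar int) : Prop :=
  exists2 s, chain_idx s & x = (chain_left s)%:E /\ y = (chain_right s)%:E.

End Chain.

Record signed_word (I : finType) := SignedWord {
  word_len : \bar int;
  word_sign : int -> int;
  word_letter : int -> I;
  word_len_ge0 : (0 <= word_len)%E;
  word_signP : forall k, word_sign k = 1 \/ word_sign k = -1 }.

Section Word.
Variables (I : finType) (C : I -> I -> int) (h : signed_word I).

Definition word_idx : set int := Zitv 1%:E (word_len h).

Definition word_ex : set int :=
  [set s | word_idx s /\
     exists t, [/\ word_idx t, s < t & word_letter h t = word_letter h s]].

(* k[1] *)
Definition word_next (k : int) : \bar int :=
  next_occ 1%:E (word_len h) (word_letter h) k.

(* eps_(k[1]); only used below when k[1] is finite *)
Definition word_sign_next (k : int) : int := word_sign h (fine (word_next k)).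

Definition word_mx (j k : int) : int :=
  let ej := word_sign h j in
  let ek := word_sign h k in
  let j1 := word_next j in
  let k1 := word_next k in
  let c := C (word_letter h j) (word_letter h k) in
  if k%:E == j1 then ek
  else if j%:E == k1 then - ej
  else if [&& word_sign_next j == ek, j < k, (k%:E < j1)%E & (j1 < k1)%E]
    then ek * c
  else if [&& ek == - word_sign_next k, j < k, (k%:E < k1)%E & (k1 < j1)%E]
    then ek * c
  else if [&& word_sign_next k == ej, k < j, (j%:E < k1)%E & (k1 < j1)%E]
    then - ej * c
  else if [&& ej == - word_sign_next j, k < j, (j%:E < j1)%E & (j1 < k1)%E]
    then - ej * c
  else 0.

(* Row and column finiteness of the submatrix indexed by
   word_idx x word_ex. *)
Definition locally_finite : Prop :=
  (forall j, word_idx j ->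
     finite_set [set k | word_ex k /\ word_mx j k != 0]) /\
  (forall k, word_ex k ->
     finite_set [set j | word_idx j /\ word_mx j k != 0]).

End Word.

Section WordOfChain.
Variables (I : finType) (a b : \bar int) (i : int -> I).
Variable CC : ibox_chain a b i.

Definition chain_sign (k : int) : int :=
  if (k == 1) || `[< step_left CC (k - 1) >] then 1 else -1.

Lemma chain_signP k : chain_sign k = 1 \/ chain_sign k = -1.
Proof. by rewrite /chain_sign; case: ifP; [left | right]. Qed.

Definition word_of_chain : signed_word I :=
  SignedWord (chain_color CC) (chain_len_ge0 CC) chain_signP.

End WordOfChain.

Section KashiwaraKim.
Variables (I : finType) (C : I -> I -> int) (d : I -> int).
Variables (a b : \bar int) (i : int -> I) (CC : ibox_chain a b i).

Let next := next_occ a b i.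
Let prev := prev_occ a b i.
Let al := chain_left CC.
Let be := chain_right CC.
Let h := chain_color CC.

Definition KK_horizontal (j k : int) : Prop :=
  (al j = al k /\ (be k)%:E = prev (be j)) \/
  (be j = be k /\ (al k)%:E = prev (al j)).

Definition KK_a (j k : int) : Prop :=
  [/\ in_chain CC (al j)%:E (next (be j)),
      al j = effective_end CC j &
      [&& (prev (al k) < (al j)%:E)%E, al j < al k, al k <= be k,
          ((be k)%:E < next (be j))%E & (next (be j) < next (be k))%E]].

Definition KK_b (j k : int) : Prop :=
  [/\ in_chain CC (al j)%:E (next (be j)),
      be k = effective_end CC k &
      [&& (prev (al k) < (al j)%:E)%E, al j <= be j, be j < be k,
          ((be k)%:E < next (be j))%E & (next (be j) < next (be k))%E]].

Definition KK_c (j k : int) : Prop :=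
  [/\ in_chain CC (prev (al k)) (be k)%:E,
      be k = effective_end CC k &
      [&& (prev (al j) < prev (al k))%E, (prev (al k) < (al j)%:E)%E,
          al j <= be j, be j < be k & ((be k)%:E < next (be j))%E]].

Definition KK_d (j k : int) : Prop :=
  [/\ in_chain CC (prev (al k)) (be k)%:E,
      al j = effective_end CC j &
      [&& (prev (al j) < prev (al k))%E, (prev (al k) < (al j)%:E)%E,
          al j < al k, al k <= be k & ((be k)%:E < next (be j))%E]].

Definition KK_inclined (j k : int) : Prop :=
  C (h j) (h k) < 0 /\ (KK_a j k \/ KK_b j k \/ KK_c j k \/ KK_d j k).

Definition is_KK_matrix (M : int -> int -> int) : Prop :=
  forall j k, chain_idx CC j -> chain_idx CC k ->
    [/\ d (h j) * M j k = - (d (h k) * M k j),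
        KK_horizontal j k -> M j k = 1,
        KK_inclined j k -> M j k = - C (h j) (h k) &
        0 < M j k -> KK_horizontal j k \/ KK_inclined j k].

End KashiwaraKim.

(* Main.v *)
Require Import Defs.
From HB Require Import structures.
From mathcomp Require Import all_boot all_order all_algebra.
From mathcomp Require Import all_classical constructive_ereal.
From mathcomp Require Import zify.

Import Order.TTheory GRing.Theory Num.Theory.
Local Open Scope classical_set_scope.
Local Open Scope ring_scope.

Set Implicit Arguments.
Unset Strict Implicit.

(** Think of [k] as a time. The union of the boxes up to time [k] is an interval
    [[L k, R k]], the envelope, which grows by one position at each step, on
    the left if [eps k = 1] and on the right if [eps k = -1]; the new position
    is an end of the box [k]. A box contains all occurrences of its color in
    the envelope, and this remains true until the time [k[1]] of the next box
    of the same color. The box [k] is born at time [k], dies at time [k[1]] and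
    is alive at the times [t] with [k <= t < k[1]]. At such a time the next
    occurrence of its color lies strictly right of [R t] and the previous one
    strictly left of [L t]
    ([next_occ_alive], [prev_occ_alive]). At the time [k[1]] one of those two
    occurrences enters the envelope; the sign [eps (k[1])] says which one
    ([next_right], [next_left]). Hence [[a_k, b_k^+]] is a box of the chain
    exactly when [k[1]] is finite with sign [-1], and [[a_k^-, b_k]] exactly
    when it is finite with sign [1] ([in_chain_next], [in_chain_prev]). The
    horizontal entries are read off from this ([KK_horizontalP]).

    For two colors, the four sign conditions that produce positive entries of
    the matrix of the signed word say together that the boxes [j] and [k] are
    alive at a common time and that
    - the later of the two births is that of [j] on the left or of [k] on the
      right,
    - the earlier of the two deaths is that of [j] on the right or of [k] on the
      left
    ([inclined]; the conditions that produce negative entries are the same with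
    [j] and [k] exchanged). Each of the conditions (a), (b), (c), (d) is
    likewise a conjunction of three parts: one of two geometric conditions on
    the effective ends, one of two conditions on the boxes [[a_j, b_j^+]] and
    [[a_k^-, b_k]], and the inequalities [a_k^- < a_j] and [b_k < b_j^+], which
    are the same in all four cases. The three parts correspond to the birth
    condition ([opens_inclinedP]), the death condition
    ([closes_inclined_boxes], [boxes_closes_inclined]) and the overlap of the
    lifetimes ([overlap_next_prev], [next_prev_overlap]).

    Consequently the matrix of the signed word satisfies the specification of
    the Kashiwara-Kim matrix ([word_mx_KK]), and on the index set of the chain
    this specification has at most one solution ([KK_matrix_unique]). The
    exchangeable columns agree because a box contains all the occurrences of its
    color in the range exactly when no later box has its color
    ([chain_frozenP]). *)

(** * Extrema of sets of integers *)

Section IntegerSets.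
Implicit Types (S : set int) (x m r t : int).

Lemma int_set_min S m t : (forall r, S r -> m <= r) -> S t ->
  exists2 x, S x & forall r, S r -> x <= r.
Proof.
move=> Sm St.
have exS : exists n, `[< S (m + n%:Z) >].
  exists `|t - m|%N; apply/asboolP.
  by rewrite (_ : m + _ = t) //; have := Sm _ St; lia.
case: (ex_minnP exS) => n /asboolP Sn minn; exists (m + n%:Z) => // r Sr.
have /asboolP/minn : S (m + `|r - m|%N%:Z).
  by rewrite (_ : m + _ = r) //; have := Sm _ Sr; lia.
by have := Sm _ Sr; lia.
Qed.

Lemma int_set_max S m t : (forall r, S r -> r <= m) -> S t ->
  exists2 x, S x & forall r, S r -> r <= x.
Proof.
move=> Sm St.
have [||x Sx minx] := @int_set_min [set r | S (- r)] (- m) (- t).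
- by move=> r /= /Sm; lia.
- by rewrite /= opprK; exact: St.
exists (- x) => // r Sr.
by have := minx (- r); rewrite /= opprK => /(_ Sr); lia.
Qed.

(** A finite infimum of integers is attained; the value [+oo] that stands for
    the empty set is excluded on the left-hand side because [x] is finite. *)
Lemma infimum_EFin S x :
  infimum +oo%E (EFin @` S) = x%:E <-> S x /\ forall r, S r -> x <= r.
Proof.
split=> [|[Sx minx]]; last first.
  rewrite /infimum ifF; last first.
    by apply/eqP => /seteqP[/(_ x%:E)/(_ (ex_intro2 _ _ _ Sx erefl))].
  apply: xget_subset1; last exact: is_subset1_infimums.
  split=> [_ [r Sr <-]|y]; first by rewrite lee_fin minx.
  by apply; exists x.
rewrite /infimum; case: ifPn => // /set0P[_ [t St _]].
case: xgetP => // _ -> lbx xx; move: lbx; rewrite {}xx => -[lbx ubx].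
have Sm r : S r -> x <= r by move=> Sr; rewrite -lee_fin lbx //; exists r.
have [y Sy miny] := int_set_min Sm St.
suff -> : x = y by [].
apply/eqP; rewrite eq_le Sm //= -lee_fin ubx // => _ [r Sr <-].
by rewrite lee_fin miny.
Qed.

Lemma supremum_EFin S x :
  supremum -oo%E (EFin @` S) = x%:E <-> S x /\ forall r, S r -> r <= x.
Proof.
split=> [|[Sx maxx]]; last first.
  rewrite /supremum ifF; last first.
    by apply/eqP => /seteqP[/(_ x%:E)/(_ (ex_intro2 _ _ _ Sx erefl))].
  apply: xget_subset1; last exact: is_subset1_supremums.
  split=> [_ [r Sr <-]|y]; first by rewrite lee_fin maxx.
  by apply; exists x.
rewrite /supremum; case: ifPn => // /set0P[_ [t St _]].
case: xgetP => // _ -> ubx xx; move: ubx; rewrite {}xx => -[ubx lbx].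
have Sm r : S r -> r <= x by move=> Sr; rewrite -lee_fin ubx //; exists r.
have [y Sy maxy] := int_set_max Sm St.
suff -> : x = y by [].
apply/eqP; rewrite eq_le Sm // andbT -lee_fin lbx // => _ [r Sr <-].
by rewrite lee_fin maxy.
Qed.

End IntegerSets.

(** * Neighboring occurrences of a color *)

Section Occurrences.
Variables (I : finType) (a b : \bar int) (i : int -> I).

Implicit Types s t r : int.

Variant next_occ_spec (s : int) : \bar int -> Prop :=
| NextOcc t of Zitv a b t & s < t & i t = i s
    & (forall r, Zitv a b r -> s < r -> i r = i s -> t <= r) :
    next_occ_spec s t%:E
| NoNextOcc of (forall r, Zitv a b r -> s < r -> i r <> i s) :
    next_occ_spec s +oo%E.

Lemma next_occP s : next_occ_spec s (next_occ a b i s).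
Proof.
pose S := [set t : int | [/\ Zitv a b t, s < t & i t = i s]].
have [S0|/set0P[t St]] := eqVneq S set0.
  rewrite /next_occ -/S S0 image_set0 /infimum eqxx.
  by apply: NoNextOcc => r abr sr ir; suff: S r by rewrite S0.
have [r [_ +] _|x Sx minx] := @int_set_min S s t _ St; first exact: ltW.
have -> : next_occ a b i s = x%:E by apply/infimum_EFin.
by case: Sx => *; apply: NextOcc => // r abr sr ir; apply: minx.
Qed.

Variant prev_occ_spec (s : int) : \bar int -> Prop :=
| PrevOcc t of Zitv a b t & t < s & i t = i s
    & (forall r, Zitv a b r -> r < s -> i r = i s -> r <= t) :
    prev_occ_spec s t%:E
| NoPrevOcc of (forall r, Zitv a b r -> r < s -> i r <> i s) :
    prev_occ_spec s -oo%E.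

Lemma prev_occP s : prev_occ_spec s (prev_occ a b i s).
Proof.
pose S := [set t : int | [/\ Zitv a b t, t < s & i t = i s]].
have [S0|/set0P[t St]] := eqVneq S set0.
  rewrite /prev_occ -/S S0 image_set0 /supremum eqxx.
  by apply: NoPrevOcc => r abr sr ir; suff: S r by rewrite S0.
have [r [_ +] _|x Sx maxx] := @int_set_max S s t _ St; first exact: ltW.
have -> : prev_occ a b i s = x%:E by apply/supremum_EFin.
by case: Sx => *; apply: PrevOcc => // r abr sr ir; apply: maxx.
Qed.

Lemma next_occ_EFin s t : next_occ a b i s = t%:E <->
  [/\ Zitv a b t, s < t, i t = i s &
      forall r, Zitv a b r -> s < r -> i r = i s -> t <= r].
Proof.
rewrite /next_occ infimum_EFin; split=> [[[abt st it] mint]|[abt st it mint]].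
  by split=> // r abr sr ir; apply: mint.
by split=> // r [abr sr ir]; apply: mint.
Qed.

Lemma prev_occ_EFin s t : prev_occ a b i s = t%:E <->
  [/\ Zitv a b t, t < s, i t = i s &
      forall r, Zitv a b r -> r < s -> i r = i s -> r <= t].
Proof.
rewrite /prev_occ supremum_EFin; split=> [[[abt st it] mint]|[abt st it mint]].
  by split=> // r abr sr ir; apply: mint.
by split=> // r [abr sr ir]; apply: mint.
Qed.

End Occurrences.

Lemma zitv_EFin (x y t : int) : Zitv x%:E y%:E t <-> x <= t <= y.
Proof. by rewrite /Zitv /= !lee_fin. Qed.

(** * The envelope of a chain and the life of its boxes *)

Section Envelope.
Variables (I : finType) (a b : \bar int) (i : int -> I).
Variable CC : ibox_chain a b i.

Implicit Types s t p r x y : int.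

Local Notation K := (chain_idx CC).
Local Notation al := (chain_left CC).
Local Notation be := (chain_right CC).
Local Notation h := (chain_color CC).
Local Notation eps := (chain_sign CC).

Lemma idx_ge1 s : K s -> 1 <= s.
Proof. by rewrite /chain_idx /Zitv /= lee_fin => /andP[]. Qed.

Lemma idx_down s t : K t -> 1 <= s -> s <= t -> K s.
Proof.
rewrite /chain_idx /Zitv /= !lee_fin => /andP[_ tl] -> st /=.
by apply: le_trans tl; rewrite lee_fin.
Qed.

(** Since the union of the first [s] boxes has [s] elements, its left end
    determines it. *)
Definition env_left (s : int) : int :=
  xget 0 [set x | boxes_upto (chain_box CC) s = Zitv x%:E (x + s - 1)%:E].
Definition env_right (s : int) : int := env_left s + s - 1.

Local Notation L := env_left.
Local Notation R := env_right.

Lemma boxes_uptoE s :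
  K s -> boxes_upto (chain_box CC) s = Zitv (L s)%:E (R s)%:E.
Proof.
move=> /chain_interval[x [y [Exy sE]]].
apply: (@xgetPex _ 0 [set x | _ = Zitv x%:E (x + s - 1)%:E]).
by exists x => /=; rewrite Exy; congr (Zitv _ _%:E); lia.
Qed.

Lemma in_boxes_upto s p : K s ->
  boxes_upto (chain_box CC) s p <-> L s <= p <= R s.
Proof. by move=> Ks; rewrite boxes_uptoE// zitv_EFin. Qed.

Lemma in_box_set s p : al s <= p <= be s <-> box_set (chain_box CC s) p.
Proof. by rewrite /box_set zitv_EFin. Qed.

Lemma env_homo s t : K t -> 1 <= s -> s <= t -> L t <= L s /\ R s <= R t.
Proof.
move=> Kt s1 st; have Ks := idx_down Kt s1 st.
have sub p : L s <= p <= R s -> L t <= p <= R t.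
  rewrite -!in_boxes_upto// => -[r /zitv_EFin rs pr].
  by exists r => //; apply/zitv_EFin; lia.
have := sub (L s); have := sub (R s); rewrite /R. lia.
Qed.

Lemma box_sub_env s : K s -> [/\ L s <= al s, al s <= be s & be s <= R s].
Proof.
move=> Ks; have [le_ab _ _] := chain_ibox Ks.
rewrite -/(al s) -/(be s) in le_ab.
have sub p : al s <= p <= be s -> L s <= p <= R s.
  rewrite -in_boxes_upto// in_box_set; exists s => //.
  by apply/zitv_EFin; have := idx_ge1 Ks; lia.
by have := sub (al s); have := sub (be s); split; lia.
Qed.

Lemma color_right s : K s -> i (be s) = h s.
Proof. by move=> /chain_ibox[]. Qed.

Lemma env_range s p : K s -> L s <= p <= R s -> Zitv a b p.
Proof.
move=> Ks; rewrite -in_boxes_upto// => -[r /zitv_EFin rs].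
by have [|_ + _] := @chain_ibox _ _ _ _ CC r; [apply: (idx_down Ks); lia|apply].
Qed.

(** Singletons are boxes, so a box that is largest in its color contains every
    occurrence of the color in the envelope. *)
Lemma box_full s p : K s -> i p = h s -> L s <= p <= R s -> al s <= p <= be s.
Proof.
move=> Ks ip ps; apply/in_box_set.
apply: (@chain_largest _ _ _ _ CC s Ks (p, p)) => //.
- split=> //= q /zitv_EFin/= qp; have -> : q = p by lia.
  exact: env_range ps.
- move=> q /zitv_EFin/= qp; have -> : q = p by lia.
  exact/in_boxes_upto.
by apply/zitv_EFin => /=; lia.
Qed.

(** A position of the new envelope that is not in the old one can only come from
    the new box, which therefore reaches the end that has moved. *)
Lemma env_succ s : K s -> 1 < s ->
  (L s = L (s - 1) - 1 /\ al s = L s) \/ (L s = L (s - 1) /\ be s = R s).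
Proof.
move=> Ks s1; have Ks' : K (s - 1) by apply: (idx_down Ks); lia.
have [] := @env_homo (s - 1) s Ks; [lia..|].
have new p : L s <= p <= R s -> ~ L (s - 1) <= p <= R (s - 1) ->
    al s <= p <= be s.
  rewrite -!in_boxes_upto// => -[r /zitv_EFin rs pr] np.
  have [<-|rns] := eqVneq r s; first exact/in_box_set.
  by case: np; exists r => //; apply/zitv_EFin; lia.
have [] := box_sub_env Ks; have := new (L s); have := new (R s).
by rewrite /R; lia.
Qed.

(** The intervals in the definition of a left step are nonempty, and a nonempty
    interval has only one pair of ends. *)
Lemma step_leftE s : K s -> 1 < s ->
  step_left CC (s - 1) <-> L s = L (s - 1) - 1.
Proof.
move=> Ks s1; have Ks' : K (s - 1) by apply: (idx_down Ks); lia.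
rewrite /step_left subrK; split=> [[x [y [xy]]]|Ls].
  rewrite !boxes_uptoE// => E1 E2.
  have /zitv_EFin : Zitv (L (s - 1))%:E (R (s - 1))%:E x.
    by rewrite E1; apply/zitv_EFin; lia.
  have /zitv_EFin : Zitv x%:E y%:E (L (s - 1)).
    by rewrite -E1; apply/zitv_EFin; rewrite /R; lia.
  have /zitv_EFin : Zitv (L s)%:E (R s)%:E (x - 1).
    by rewrite E2; apply/zitv_EFin; lia.
  have /zitv_EFin : Zitv (x - 1)%:E y%:E (L s).
    by rewrite -E2; apply/zitv_EFin; rewrite /R; lia.
  lia.
exists (L (s - 1)), (R (s - 1)); split; first by rewrite /R; lia.
  exact: boxes_uptoE.
by rewrite boxes_uptoE// Ls /R; congr (Zitv _ _%:E); lia.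
Qed.

(** The sign [1] of the first box does not come from a left step, but that box
    is a single position, equal to both ends of the envelope. *)
Lemma chain_sign_left s : K s -> eps s = 1 ->
  al s = L s /\ (1 < s -> R s = R (s - 1)).
Proof.
move=> Ks; rewrite /chain_sign; have [->|s1] := eqVneq s 1.
  have K1 : K 1 by apply: (idx_down Ks) => //; exact: idx_ge1.
  by have [] := box_sub_env K1; rewrite /R; lia.
have {}s1 : 1 < s by have := idx_ge1 Ks; lia.
case: asboolP => // /(step_leftE Ks s1) Ls _.
by have := env_succ Ks s1; rewrite /R; lia.
Qed.

Lemma chain_sign_right s : K s -> eps s = -1 ->
  [/\ 1 < s, be s = R s & L s = L (s - 1)].
Proof.
move=> Ks; rewrite /chain_sign; have [//|s1] := eqVneq s 1.
have {}s1 : 1 < s by have := idx_ge1 Ks; lia.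
case: asboolP => // Ls _.
have := env_succ Ks s1; have := step_leftE Ks s1.
by case=> _ nLs [[/nLs]|[]].
Qed.

Lemma effective_endE s : effective_end CC s = if eps s == 1 then al s else be s.
Proof. by rewrite /effective_end /chain_sign; case: ifP. Qed.

(** The position added to the envelope at time [r] is an end of the box
    [r], so it has the color of that box. *)
Lemma env_color s p : K s -> L s <= p <= R s ->
  exists r, [/\ 1 <= r, r <= s, L r <= p <= R r & h r = i p].
Proof.
move=> Ks; have := idx_ge1 Ks.
have [n] : exists n, s = n%:Z by exists `|s|%N; have := idx_ge1 Ks; lia.
elim: n s Ks p => [|n IH] s Ks p sE s1 ps; first lia.
have [s1'|s1'] := eqVneq s 1.
  exists s; split=> //; rewrite /chain_color; congr i.
  by have [] := box_sub_env Ks; move: ps; rewrite /R s1'; lia.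
have Ks' : K (s - 1) by apply: (idx_down Ks); lia.
have [ps'|ps'] := boolP (L (s - 1) <= p <= R (s - 1)).
  have [||r [r1 rs pr hr]] := IH _ Ks' p _ _ ps'; [lia..|].
  by exists r; split=> //; lia.
exists s; split=> //; have [|[Ls als]|[Ls bes]] := env_succ Ks; first lia.
  rewrite /chain_color; congr i; move: ps ps'; rewrite /R; lia.
rewrite -color_right//; congr i; move: ps ps' bes; rewrite /R; lia.
Qed.

Local Notation nxt := (word_next (word_of_chain CC)).

Lemma chain_nextP s : next_occ_spec 1%:E (chain_len CC) h s (nxt s).
Proof. exact: next_occP. Qed.

Lemma chain_next_EFin s t : nxt s = t%:E -> [/\ K t, s < t & h t = h s].
Proof. by case: chain_nextP => // u ? ? ? _ [<-]. Qed.

(** Every occurrence of the color in the envelope was there when the last box of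
    this color was formed, by [env_color]; until the next one, that box is [s]. *)
Lemma box_full_alive s t p : K s -> K t -> s <= t -> (t%:E < nxt s)%E ->
  i p = h s -> L t <= p <= R t -> al s <= p <= be s.
Proof.
move=> Ks Kt st tn ip pt; have [r [r1 rt pr hr]] := env_color Kt pt.
have rs : r <= s.
  have Kr : K r by apply: (idx_down Kt).
  rewrite leNgt; apply/negP => sr; move: tn.
  case: chain_nextP => [u _ _ _ minu|/(_ r Kr sr)]; last by rewrite hr.
  by have := minu r Kr sr; rewrite hr ip lte_fin => /(_ erefl); lia.
apply: box_full => //; have [] := env_homo Ks r1 rs; lia.
Qed.

Lemma next_occ_alive s t : K s -> K t -> s <= t -> (t%:E < nxt s)%E ->
  ((R t)%:E < next_occ a b i (be s))%E.
Proof.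
move=> Ks Kt st tn; case: next_occP => [p abp sp ip _|_]; last exact: ltry.
rewrite lte_fin ltNge; apply/negP => pt.
have [Ls les lRs] := box_sub_env Ks.
have [LL RR] := env_homo Kt (idx_ge1 Ks) st.
have := @box_full_alive s t p Ks Kt st tn.
by rewrite ip color_right// => /(_ erefl); lia.
Qed.

Lemma prev_occ_alive s t : K s -> K t -> s <= t -> (t%:E < nxt s)%E ->
  (prev_occ a b i (al s) < (L t)%:E)%E.
Proof.
move=> Ks Kt st tn; case: prev_occP => [p abp sp ip _|_]; last exact: ltNyr.
rewrite lte_fin ltNge; apply/negP => pt.
have [Ls les lRs] := box_sub_env Ks.
have [LL RR] := env_homo Kt (idx_ge1 Ks) st.
have := @box_full_alive s t p Ks Kt st tn ip; lia.
Qed.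


(** Just before time [t] the box [s] still had all the occurrences in the
    envelope, so the position added at time [t] is the only new one. *)
Lemma next_right s t : K s -> nxt s = t%:E -> eps t = -1 ->
  [/\ al t = al s, be t = R t & next_occ a b i (be s) = (R t)%:E].
Proof.
move=> Ks nst eps_t; have [Kt st ht] := chain_next_EFin nst.
have [t1 bet Lt] := chain_sign_right Kt eps_t.
have Kt' : K (t - 1) by apply: (idx_down Kt); lia.
have alive : ((t - 1)%:E < nxt s)%E by rewrite nst lte_fin; lia.
have st' : s <= t - 1 by lia.
have full p : i p = h s -> L (t - 1) <= p <= R (t - 1) -> al s <= p <= be s.
  exact: box_full_alive.
have [LL RR] := env_homo Kt' (idx_ge1 Ks) st'.
have [Ls les lRs] := box_sub_env Ks; have [Lt' let_ lRt] := box_sub_env Kt.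
have Rt : R t = R (t - 1) + 1 by rewrite /R; lia.
have fromt := @box_full t (al s) Kt (esym ht).
split=> //.
  have := full (al t) ht; lia.
apply/next_occ_EFin; split.
- by apply: (@env_range t) => //; lia.
- lia.
- by rewrite -bet !color_right.
move=> r abr sr ir; have := full r; rewrite ir color_right// => /(_ erefl).
lia.
Qed.

Lemma next_left s t : K s -> nxt s = t%:E -> eps t = 1 ->
  [/\ be t = be s, al t = L t & prev_occ a b i (al s) = (L t)%:E].
Proof.
move=> Ks nst eps_t; have [Kt st ht] := chain_next_EFin nst.
have [alt Rt] := chain_sign_left Kt eps_t.
have := idx_ge1 Ks => s1.
have Kt' : K (t - 1) by apply: (idx_down Kt); lia.
have alive : ((t - 1)%:E < nxt s)%E by rewrite nst lte_fin; lia.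
have st' : s <= t - 1 by lia.
have full p : i p = h s -> L (t - 1) <= p <= R (t - 1) -> al s <= p <= be s.
  exact: box_full_alive.
have [LL RR] := env_homo Kt' s1 st'.
have [Ls les lRs] := box_sub_env Ks; have [Lt' let_ lRt] := box_sub_env Kt.
have Lt : L t = L (t - 1) - 1 by move: Rt; rewrite /R; lia.
have fromt : L t <= be s <= R t -> al t <= be s <= be t.
  by apply: box_full => //; rewrite color_right.
split=> //.
  by have := full (be t); rewrite color_right// => /(_ ht); lia.
apply/prev_occ_EFin; split.
- by apply: (@env_range t) => //; lia.
- lia.
- by rewrite -alt.
by move=> r abr sr /full; lia.
Qed.

(** The inclusion is strict since the box [t] reaches the position that entered
    the envelope at time [t], after the box [s]. *)
Lemma box_grow s t : K s -> K t -> s < t -> h t = h s ->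
  [/\ al t <= al s, be s <= be t & al t < al s \/ be s < be t].
Proof.
move=> Ks Kt st ht; have s1 := idx_ge1 Ks.
have Kt' : K (t - 1) by apply: (idx_down Kt); lia.
have [LL RR] : L (t - 1) <= L s /\ R s <= R (t - 1).
  by apply: env_homo => //; lia.
have [LL' RR'] : L t <= L (t - 1) /\ R (t - 1) <= R t.
  by apply: env_homo => //; lia.
have [Ls les lRs] := box_sub_env Ks.
have alP := @box_full t (al s) Kt (esym ht).
have beP : L t <= be s <= R t -> al t <= be s <= be t.
  by apply: box_full => //; rewrite color_right.
have t1 : 1 < t by lia.
have grow := env_succ Kt t1.
have RE : R t = L t + t - 1 /\ R (t - 1) = L (t - 1) + (t - 1) - 1 by [].
split; lia.
Qed.


Lemma chain_next_ex s t : K t -> s < t -> h t = h s ->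
  exists2 u, nxt s = u%:E & u <= t.
Proof.
move=> Kt st ht; case: chain_nextP => [u _ _ _ minu|/(_ t Kt st)//].
by exists u => //; apply: minu.
Qed.

(** The first box of the same color after [s], the box [u] below, lies between
    the boxes [s] and [t]. If it had grown on the left, then [t] would not have
    the left end of [s]; so it has the ends of [t], and [t = u] because boxes of
    one color grow strictly. *)
Lemma next_occ_box s t : K s -> K t ->
  al t = al s /\ next_occ a b i (be s) = (be t)%:E <->
  nxt s = t%:E /\ eps t = -1.
Proof.
move=> Ks Kt; split=> [[als nbes]|[nst eps_t]]; last first.
  have [-> bet ->] := next_right Ks nst eps_t.
  by rewrite bet.
have /next_occ_EFin[_ bes _ _] := nbes.
have ht : h t = h s by rewrite /chain_color als.
have st : s < t.
  rewrite ltNge; apply/negP => ts; have [ts'|ts'] := eqVneq t s.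
    by move: bes; rewrite ts' ltxx.
  by have [|_ + _] := box_grow Kt Ks _ (esym ht); lia.
have [u nu ut] := chain_next_ex Kt st ht.
have [Ku su hu] := chain_next_EFin nu.
have grow : u = t \/
    [/\ al t <= al u, be u <= be t & al t < al u \/ be u < be t].
  have [->|ut'] := eqVneq u t; [by left|right].
  by apply: box_grow; rewrite ?hu//; lia.
have [epsu|epsu] := chain_signP CC u.
  have [_ alu /prev_occ_EFin[_ Lu _ _]] := next_left Ks nu epsu.
  by case: grow => [?|[]]; [subst u|]; lia.
have [alu beu nbe] := next_right Ks nu epsu.
have but : be u = be t by move: nbes; rewrite nbe beu => -[].
by case: grow => [<-//|[_ _]]; lia.
Qed.

Lemma prev_occ_box s t : K s -> K t ->
  prev_occ a b i (al s) = (al t)%:E /\ be t = be s <->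
  nxt s = t%:E /\ eps t = 1.
Proof.
move=> Ks Kt; split=> [[pals bes]|[nst eps_t]]; last first.
  have [-> alt ->] := next_left Ks nst eps_t.
  by rewrite alt.
have /prev_occ_EFin[_ als _ _] := pals.
have ht : h t = h s by rewrite -!color_right// bes.
have st : s < t.
  rewrite ltNge; apply/negP => ts; have [ts'|ts'] := eqVneq t s.
    by move: als; rewrite ts' ltxx.
  by have [|+ _ _] := box_grow Kt Ks _ (esym ht); lia.
have [u nu ut] := chain_next_ex Kt st ht.
have [Ku su hu] := chain_next_EFin nu.
have grow : u = t \/
    [/\ al t <= al u, be u <= be t & al t < al u \/ be u < be t].
  have [->|ut'] := eqVneq u t; [by left|right].
  by apply: box_grow; rewrite ?hu//; lia.
have [epsu|epsu] := chain_signP CC u; last first.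
  have [_ beu /next_occ_EFin[_ Ru _ _]] := next_right Ks nu epsu.
  by case: grow => [?|[]]; [subst u|]; lia.
have [beu alu pal] := next_left Ks nu epsu.
have alut : al u = al t by move: pals; rewrite pal alu => -[].
by case: grow => [<-//|[_ _]]; lia.
Qed.

Lemma in_chain_next s : K s ->
  in_chain CC (al s)%:E (next_occ a b i (be s)) <->
  exists2 t, nxt s = t%:E & eps t = -1.
Proof.
move=> Ks; split=> [[t Kt [[alt] bet]]|[t nst eps_t]].
  have [nst eps_t] : nxt s = t%:E /\ eps t = -1 by apply/next_occ_box.
  by exists t.
have [Kt _ _] := chain_next_EFin nst; exists t => //.
by have [-> ->] : al t = al s /\ next_occ a b i (be s) = (be t)%:E
  by apply/next_occ_box.
Qed.

Lemma in_chain_prev s : K s ->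
  in_chain CC (prev_occ a b i (al s)) (be s)%:E <->
  exists2 t, nxt s = t%:E & eps t = 1.
Proof.
move=> Ks; split=> [[t Kt [alt [bet]]]|[t nst eps_t]].
  have [nst eps_t] : nxt s = t%:E /\ eps t = 1 by apply/prev_occ_box.
  by exists t.
have [Kt _ _] := chain_next_EFin nst; exists t => //.
by have [-> ->] : prev_occ a b i (al s) = (al t)%:E /\ be t = be s
  by apply/prev_occ_box.
Qed.

Lemma box_in_range s : K s -> Zitv a b (al s) /\ Zitv a b (be s).
Proof.
move=> Ks; have [? ? ?] := box_sub_env Ks.
by split; apply: (env_range Ks); lia.
Qed.

(** Passing to the previous and to the next occurrence are inverse to each
    other, so each horizontal case compares a box with an extension of it by
    one occurrence. *)
Lemma KK_horizontalP j k : K j -> K k ->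
  KK_horizontal CC j k <->
  (nxt k = j%:E /\ eps j = -1) \/ (nxt j = k%:E /\ eps k = 1).
Proof.
move=> Kj Kk; rewrite -next_occ_box// -prev_occ_box// /KK_horizontal.
have dual : (be k)%:E = prev_occ a b i (be j) <->
    next_occ a b i (be k) = (be j)%:E.
  have [_ Zk] := box_in_range Kk; have [_ Zj] := box_in_range Kj.
  split=> [/esym/prev_occ_EFin[_ kj ij maxk]|/next_occ_EFin[_ kj ij minj]].
    apply/next_occ_EFin; split=> // r Zr kr ir; rewrite leNgt; apply/negP => rj.
    by have := maxk r Zr rj; rewrite ir ij => /(_ erefl); lia.
  apply/esym/prev_occ_EFin; split=> // r Zr rj ir.
  rewrite leNgt; apply/negP => kr.
  by have := minj r Zr kr; rewrite ir ij => /(_ erefl); lia.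
by rewrite dual; split=> -[[? ?]|[? ?]]; [left|right|left|right].
Qed.

(** A box after [s] of its color would properly extend it. Without such a box,
    [s] stays alive forever, and by then the envelope has reached every position
    of the range. *)
Lemma chain_frozenP s : chain_range CC = Zitv a b -> K s ->
  chain_frozen CC s <-> forall t, K t -> s < t -> h t <> h s.
Proof.
move=> rangeE Ks.
split=> [[_ [j [/esym/infimum_EFin alP /esym/supremum_EFin beP]]]|none].
  move=> t Kt st ht; case: alP beP => -[_ _ ij] mina [_ maxb].
  have [Za Zb] := box_in_range Kt; have [] := box_grow Ks Kt st ht.
  have := mina (al t); have := maxb (be t).
  rewrite /= color_right// ht -[i (al t)]/(h t) ht -ij.
  have /andP[-> _] := Za; have /andP[_ ->] := Zb.
  move=> /(_ (And3 Zb isT erefl)) + /(_ (And3 Za isT erefl)); lia.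
have full r : Zitv a b r -> i r = h s -> al s <= r <= be s.
  rewrite -rangeE => -[q Kq rq] ir.
  have {}rq : al q <= r <= be q by apply/in_box_set.
  have nE : nxt s = +oo%E by case: chain_nextP => // t Kt st /(none t Kt st).
  have alive p : K p -> s <= p -> L p <= r <= R p -> al s <= r <= be s.
    by move=> Kp sp; apply: box_full_alive; rewrite // nE ltry.
  have [? ? ?] := box_sub_env Kq.
  have [sq|qs] := leP s q; first by apply: (alive q) => //; lia.
  apply: (alive s) => //.
  by have [] := env_homo Ks (idx_ge1 Kq) (ltW qs); lia.
have [Za Zb] := box_in_range Ks.
split=> //; exists (h s); split; apply/esym.
  apply/infimum_EFin; split=> [|r [Zr _ ir]]; last by have := full r Zr ir; lia.
  by split=> //; case/andP: Za.
apply/supremum_EFin; split=> [|r [Zr _ ir]]; last by have := full r Zr ir; lia.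
by split=> //; [case/andP: Zb|exact: color_right].
Qed.

End Envelope.

(** * Signs and positive entries *)

Section SignedWord.
Variables (I : finType) (w : signed_word I).
Implicit Types j k t : int.

Local Notation nxt := (word_next w).
Local Notation eps := (word_sign w).
Local Notation eps_next := (word_sign_next w).
Local Notation h := (word_letter w).

(** With the sign [1] read as left and [-1] as right, this is the condition on
    the later of the two births: [j] on the left or [k] on the right. *)
Definition opens_inclined j k : bool :=
  ((k < j) && (eps j == 1)) || ((j < k) && (eps k == -1)).

(** The condition on the earlier of the two deaths: [j] extends to the right or
    [k] to the left. The strict inequalities make the time of that death
    finite. *)
Definition closes_inclined j k : bool :=
  ((nxt j < nxt k)%E && (eps_next j == -1)) ||
  ((nxt k < nxt j)%E && (eps_next k == 1)).

Definition inclined j k : bool :=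
  [&& (j%:E < nxt k)%E, (k%:E < nxt j)%E, opens_inclined j k
    & closes_inclined j k].

Lemma word_next_gt j : (j%:E < nxt j)%E.
Proof. by rewrite /word_next; case: next_occP => *; rewrite ?lte_fin ?ltry. Qed.

Lemma word_next_fin j x : (nxt j < x)%E -> exists t, nxt j = t%:E.
Proof.
rewrite /word_next; case: next_occP => [t _ _ _ _ _|_]; first by exists t.
by rewrite ltNge leey.
Qed.

Lemma word_next_letter j k : nxt j = k%:E -> h k = h j.
Proof. by move/next_occ_EFin => []. Qed.

Lemma word_next_min j k : word_idx w k -> h k = h j -> j < k ->
  (nxt j <= k%:E)%E.
Proof.
move=> Kk hk jk; rewrite /word_next.
case: next_occP => [t _ _ _ mint|/(_ k Kk jk)//].
by rewrite lee_fin; apply: mint.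
Qed.

Lemma inclined_asym j k : inclined j k -> ~~ inclined k j.
Proof.
rewrite /inclined /opens_inclined => /and4P[-> -> + _] /=.
case: (word_signP w j) => ->; case: (word_signP w k) => ->;
  by case: (ltgtP j k).
Qed.

Variable C : I -> I -> int.

(** Boxes of the same color are never alive together, so only the entries for
    consecutive occurrences remain. *)
Lemma word_mx_same_letter j k : word_idx w j -> word_idx w k -> h j = h k ->
  word_mx C w j k =
  if k%:E == nxt j then eps k else if j%:E == nxt k then - eps j else 0.
Proof.
move=> Kj Kk hjk; rewrite /word_mx; case: eqP => // _; case: eqP => // _.
have dis x y : word_idx w y -> h y = h x -> x < y -> (y%:E < nxt x)%E = false.
  move=> Ky hy xy; apply/negP; rewrite ltNge => /negP; apply.
  exact: word_next_min.
have dis' x y : word_idx w y -> h y = h x -> x < y -> (nxt y < nxt x)%E = false.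
  move=> Ky hy xy; apply/negP => yx; have := dis _ _ Ky hy xy.
  by rewrite (lt_trans (word_next_gt y) yx).
case: (ltgtP j k) => jk; rewrite ?andbF //=.
- by rewrite (dis j k)// (dis' j k)// !andbF.
- by rewrite (dis k j)// (dis' k j)// !andbF.
Qed.

(** Each of the four cases of the definition contains two sign patterns: the one
    that makes the entry positive is a case of [inclined j k], the opposite one
    a case of [inclined k j]. *)
Lemma word_mx_inclined j k : h j <> h k ->
  word_mx C w j k =
  if inclined j k then - C (h j) (h k)
  else if inclined k j then C (h j) (h k) else 0.
Proof.
move=> hjk; rewrite /word_mx.
case: eqP => [/esym/word_next_letter/esym//|_].
case: eqP => [/esym/word_next_letter//|_].
have jj := word_next_gt j; have kk := word_next_gt k.
have jk_jk : j < k -> (j%:E < nxt k)%E.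
  by move=> jk; apply: lt_trans kk; rewrite lte_fin.
have kj_kj : k < j -> (k%:E < nxt j)%E.
  by move=> jk; apply: lt_trans jj; rewrite lte_fin.
have jk_kj : (nxt j < nxt k)%E -> (j%:E < nxt k)%E by apply: lt_trans.
have kj_jk : (nxt k < nxt j)%E -> (k%:E < nxt j)%E by apply: lt_trans.
rewrite /inclined /opens_inclined /closes_inclined /word_sign_next.
have [e1 e2 e3] : [/\ (1 == -1 :> int) = false, (-1 == 1 :> int) = false &
  - - 1 = 1 :> int] by [].
(* Of the relative orders of the two births and the two deaths, only the four
   with overlapping lifetimes leave anything to compare. *)
move: jk_jk kj_kj jk_kj kj_jk.
case: (j%:E < nxt k)%E; case: (k%:E < nxt j)%E;
case: (ltgtP j k) => _; case: (ltgtP (nxt j) (nxt k)) => _ p q r s;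
  try discriminate (p isT); try discriminate (q isT);
  try discriminate (r isT); try discriminate (s isT); clear p q r s;
rewrite ?andbF ?andbT ?orbF ?jj ?kk //=;
  case: (word_signP w j) => ej; case: (word_signP w k) => ek;
  case: (word_signP w (fine (nxt j))) => ej';
  case: (word_signP w (fine (nxt k))) => ek';
  rewrite ?ej ?ek ?ej' ?ek' ?e3 ?eqxx ?e1 ?e2 /= ?mul1r ?mulN1r ?opprK //.
Qed.

End SignedWord.

(** * Inclined entries *)

Section KashiwaraKimSigns.
Variables (I : finType) (a b : \bar int) (i : int -> I).
Variable CC : ibox_chain a b i.
Implicit Types j k t u v : int.

Local Notation K := (chain_idx CC).
Local Notation al := (chain_left CC).
Local Notation be := (chain_right CC).
Local Notation h := (chain_color CC).
Local Notation eps := (chain_sign CC).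
Local Notation L := (env_left CC).
Local Notation R := (env_right CC).
Local Notation w := (word_of_chain CC).
Local Notation nxt := (word_next w).
Local Notation next := (next_occ a b i).
Local Notation prev := (prev_occ a b i).

Lemma color_neq_al j k : h j <> h k -> al j != al k.
Proof. by move=> hjk; apply/eqP => E; apply: hjk; rewrite /chain_color E. Qed.

Lemma color_neq_be j k : K j -> K k -> h j <> h k -> be j != be k.
Proof.
by move=> Kj Kk hjk; apply/eqP => E; apply: hjk; rewrite -!color_right// E.
Qed.

(** The box born later starts at an end of the envelope, which is at least as
    far out as the other box; distinct colors make the comparison strict. In the
    converse direction, a one-position box has both ends as effective ends
    whatever its sign, and the same comparison of the envelopes rules out the
    wrong sign. *)
Lemma opens_inclinedP j k : K j -> K k -> h j <> h k ->
  opens_inclined w j k <->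
  (al j = effective_end CC j /\ al j < al k) \/
  (be k = effective_end CC k /\ be j < be k).
Proof.
move=> Kj Kk hjk; rewrite /opens_inclined /=.
have nal := color_neq_al hjk; have nbe := color_neq_be Kj Kk hjk.
have [? ? ?] := box_sub_env Kj; have [? ? ?] := box_sub_env Kk.
have j1 := idx_ge1 Kj; have k1 := idx_ge1 Kk.
have [jk|kj|jk] := ltgtP j k; last by case: hjk; rewrite jk.
- have [LL RR] := env_homo Kk j1 (ltW jk).
  have [ek|ek] := chain_signP CC k; rewrite ek /=.
    have [alk _] := chain_sign_left Kk ek.
    by split=> // -[[_]|[]]; rewrite ?effective_endE ?ek /=; lia.
  have [_ bek _] := chain_sign_right Kk ek.
  split=> // _; right; split; last lia.
  by rewrite effective_endE ek.
- have [LL RR] := env_homo Kj k1 (ltW kj).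
  have [ej|ej] := chain_signP CC j; rewrite ej /=.
    have [alj _] := chain_sign_left Kj ej.
    split=> // _; left; split; last lia.
    by rewrite effective_endE ej.
  have [_ bej _] := chain_sign_right Kj ej.
  by split=> // -[[]|[_]]; rewrite ?effective_endE ?ej /=; lia.
Qed.

(** The box that survives is still alive when the other one is extended, so its
    neighboring occurrences lie outside the envelope, whose end is the
    position added by the extension. *)
Lemma closes_inclined_boxes j k : K j -> K k -> h j <> h k ->
  (j%:E < nxt k)%E -> (k%:E < nxt j)%E ->
  closes_inclined w j k ->
  (in_chain CC (al j)%:E (next (be j)) /\ (next (be j) < next (be k))%E) \/
  (in_chain CC (prev (al k)) (be k)%:E /\ (prev (al j) < prev (al k))%E).
Proof.
move=> Kj Kk hjk jnk knj; rewrite /closes_inclined /word_sign_next /=.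
rewrite in_chain_next// in_chain_prev//.
case/orP => /andP[].
  move=> /[dup] unk /word_next_fin[u nj]; rewrite nj /= in unk knj * => /eqP eu.
  left; split; first by exists u.
  have [_ _ ->] := next_right Kj nj eu; have [Ku _ _] := chain_next_EFin nj.
  by apply: next_occ_alive => //; rewrite lte_fin in knj; exact: ltW.
move=> /[dup] vnj /word_next_fin[v nk]; rewrite nk /= in vnj jnk * => /eqP ev.
right; split; first by exists v.
have [_ _ ->] := next_left Kk nk ev; have [Kv _ _] := chain_next_EFin nk.
by apply: prev_occ_alive => //; rewrite lte_fin in jnk; exact: ltW.
Qed.

(** If [j] extends to the right and [k] dies even earlier, then [k] extends to
    the left, because an extension of [k] to the right would put [b_k^+] in the
    envelope that ends at [b_j^+], against [b_j^+ < b_k^+]. The other case is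
    its mirror image. *)
Lemma boxes_closes_inclined j k : K j -> K k -> h j <> h k ->
  (in_chain CC (al j)%:E (next (be j)) /\ (next (be j) < next (be k))%E) \/
  (in_chain CC (prev (al k)) (be k)%:E /\ (prev (al j) < prev (al k))%E) ->
  closes_inclined w j k.
Proof.
move=> Kj Kk hjk; rewrite in_chain_next// in_chain_prev//.
rewrite /closes_inclined /word_sign_next /=.
have nuv u v : nxt j = u%:E -> nxt k = v%:E -> u != v.
  move=> /chain_next_EFin[_ _ hu] /chain_next_EFin[_ _ hv]; apply/eqP => uv.
  by apply: hjk; rewrite -hu -hv uv.
case=> -[[t nt et] lt_ends]; have [Kt _ _] := chain_next_EFin nt.
  have [tk|kt] := ltP t%:E (nxt k); first by rewrite nt /= tk et.
  have [v nk] := word_next_fin (le_lt_trans kt (ltry t)).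
  have [Kv _ _] := chain_next_EFin nk.
  have vt : v < t by move: kt (nuv t v nt nk); rewrite nk lee_fin; lia.
  have [ev|ev] := chain_signP CC v.
    by rewrite nt nk /= ev !lte_fin vt orbT.
  have [_ _ nEk] := next_right Kk nk ev; have [_ _ nEj] := next_right Kj nt et.
  have [] := env_homo Kt (idx_ge1 Kv) (ltW vt).
  by move: lt_ends; rewrite nEj nEk lte_fin; lia.
have [tj|jt] := ltP t%:E (nxt j); first by rewrite nt /= tj et orbT.
have [u nj] := word_next_fin (le_lt_trans jt (ltry t)).
have [Ku _ _] := chain_next_EFin nj.
have ut : u < t by move: jt (nuv u t nj nt); rewrite nj lee_fin; lia.
have [eu|eu] := chain_signP CC u; last by rewrite nt nj /= eu !lte_fin ut.
have [_ _ pEj] := next_left Kj nj eu; have [_ _ pEk] := next_left Kk nt et.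
have [] := env_homo Kt (idx_ge1 Ku) (ltW ut).
by move: lt_ends; rewrite pEj pEk lte_fin; lia.
Qed.

(** Both boxes are alive at the later of the two births. *)
Lemma overlap_next_prev j k : K j -> K k ->
  (j%:E < nxt k)%E -> (k%:E < nxt j)%E ->
  (prev (al k) < (al j)%:E)%E /\ ((be k)%:E < next (be j))%E.
Proof.
move=> Kj Kk jnk knj; have jj := word_next_gt w j; have kk := word_next_gt w k.
pose t := Num.max j k.
have [Kt jt kt] : [/\ K t, j <= t & k <= t].
  by rewrite /t !le_max !lexx orbT; split=> //; case: (leP j k).
have tj : (t%:E < nxt j)%E by rewrite /t; case: (leP j k).
have tk : (t%:E < nxt k)%E by rewrite /t; case: (leP j k).
have [LL _] := env_homo Kt (idx_ge1 Kj) jt.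
have [_ RR] := env_homo Kt (idx_ge1 Kk) kt.
have [? ? ?] := box_sub_env Kj; have [? ? ?] := box_sub_env Kk.
split.
  by apply: lt_le_trans (prev_occ_alive Kk Kt kt tk) _; rewrite lee_fin; lia.
by apply: le_lt_trans (next_occ_alive Kj Kt jt tj); rewrite lee_fin; lia.
Qed.

(** Suppose that [k] is older and dies no later than the birth of [j]. Then its
    death is the earlier one, hence an extension to the left, which puts [a_k^-]
    in the envelope at the birth of [j]. But [j] starts at the left end of that
    envelope, against [a_k^- < a_j]. The other case is its mirror image. *)
Lemma next_prev_overlap j k : K j -> K k -> h j <> h k ->
  opens_inclined w j k -> closes_inclined w j k ->
  (prev (al k) < (al j)%:E)%E -> ((be k)%:E < next (be j))%E ->
  (j%:E < nxt k)%E /\ (k%:E < nxt j)%E.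
Proof.
move=> Kj Kk hjk + + prevk nextj.
have jj := word_next_gt w j; have kk := word_next_gt w k.
case/orP => /andP[jk /eqP /= e]; rewrite /closes_inclined /word_sign_next /=.
  have [alj _] := chain_sign_left Kj e.
  move=> cl; split; last by apply: lt_trans jj; rewrite lte_fin.
  rewrite ltNge; apply/negP => nkj.
  have nkj' : (nxt k < nxt j)%E by apply: le_lt_trans jj.
  move: cl; rewrite nkj' ltNge (ltW nkj') /= => /eqP.
  case nk : (nxt k) nkj => [v||] //=; last by rewrite nk in kk.
  rewrite lee_fin => vj ev; have [Kv _ _] := chain_next_EFin nk.
  have [_ _ pE] := next_left Kk nk ev.
  have [] := env_homo Kj (idx_ge1 Kv) vj.
  by move: prevk; rewrite pE lte_fin; lia.
have [_ bek _] := chain_sign_right Kk e.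
move=> cl; split; first by apply: lt_trans kk; rewrite lte_fin.
rewrite ltNge; apply/negP => njk.
have njk' : (nxt j < nxt k)%E by apply: le_lt_trans kk.
move: cl; rewrite njk' [(nxt k < _)%E]ltNge (ltW njk') /= orbF => /eqP.
case nj : (nxt j) njk => [u||] //=; last by rewrite nj in jj.
rewrite lee_fin => uk eu; have [Ku _ _] := chain_next_EFin nj.
have [_ _ nE] := next_right Kj nj eu.
have [] := env_homo Kk (idx_ge1 Ku) uk.
by move: nextj; rewrite nE lte_fin; lia.
Qed.

Lemma KK_inclinedP j k : K j -> K k -> h j <> h k ->
  (KK_a CC j k \/ KK_b CC j k \/ KK_c CC j k \/ KK_d CC j k) <->
  inclined w j k.
Proof.
move=> Kj Kk hjk; have [_ ablej _] := box_sub_env Kj.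
have [_ ablek _] := box_sub_env Kk.
split=> [kk|/and4P[jnk knj op cl]].
  have [op [cl [pk nj]]] :
      ((al j = effective_end CC j /\ al j < al k) \/
       (be k = effective_end CC k /\ be j < be k)) /\
      ((in_chain CC (al j)%:E (next (be j)) /\ (next (be j) < next (be k))%E) \/
       (in_chain CC (prev (al k)) (be k)%:E /\
        (prev (al j) < prev (al k))%E)) /\
      (prev (al k) < (al j)%:E)%E /\ ((be k)%:E < next (be j))%E.
    by case: kk => [|[|[|]]] [? ? /and5P[]];
      do ?split=> //; tauto.
  have {}op := (opens_inclinedP Kj Kk hjk).2 op.
  have {}cl := boxes_closes_inclined Kj Kk hjk cl.
  have [jnk knj] := next_prev_overlap Kj Kk hjk op cl pk nj.
  exact/and4P.
have [pk nj] := overlap_next_prev Kj Kk jnk knj.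
have [[ej alt]|[ek blt]] := (opens_inclinedP Kj Kk hjk).1 op;
have [[inj nlt]|[ink plt]] := closes_inclined_boxes Kj Kk hjk jnk knj cl.
- by left; split=> //; apply/and5P.
- by right; right; right; split=> //; apply/and5P.
- by right; left; split=> //; apply/and5P.
- by right; right; left; split=> //; apply/and5P.
Qed.

End KashiwaraKimSigns.

(** * Comparison of the matrices *)

Section Matrices.
Variables (I : finType) (C : I -> I -> int) (d : I -> int).
Variables (a b : \bar int) (i : int -> I) (CC : ibox_chain a b i).
Implicit Types j k : int.

Local Notation K := (chain_idx CC).
Local Notation h := (chain_color CC).
Local Notation w := (word_of_chain CC).

(** The specification determines the positive entries, and skew-symmetrizability
    moves every negative entry to a positive one. *)
Lemma KK_matrix_unique M N : (forall x, 0 < d x) ->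
  is_KK_matrix C d CC M -> is_KK_matrix C d CC N ->
  forall j k, K j -> K k -> M j k = N j k.
Proof.
move=> d_gt0 KM KN.
have pos M1 M2 j k : is_KK_matrix C d CC M1 -> is_KK_matrix C d CC M2 ->
    K j -> K k -> 0 < M1 j k -> M2 j k = M1 j k.
  move=> K1 K2 Kj Kk M1_gt0; have [_ h1 i1 /(_ M1_gt0)] := K1 j k Kj Kk.
  have [_ h2 i2 _] := K2 j k Kj Kk.
  by case=> H; [rewrite h1// h2|rewrite i1// i2].
have skew M1 j k : is_KK_matrix C d CC M1 -> K j -> K k ->
    M1 j k <= 0 -> 0 <= M1 k j.
  move=> K1 Kj Kk M1_le0; have [E _ _ _] := K1 j k Kj Kk.
  rewrite -(pmulr_rge0 _ (d_gt0 (h k))) -oppr_le0 -E.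
  by rewrite pmulr_rle0.
move=> j k Kj Kk.
have [M_gt0|M_le0] := ltP 0 (M j k); first by rewrite (pos M N).
have [N_gt0|N_le0] := ltP 0 (N j k); first by rewrite (pos N M).
apply: (mulfI (lt0r_neq0 (d_gt0 (h j)))).
have [-> _ _ _] := KM j k Kj Kk; have [-> _ _ _] := KN j k Kj Kk.
have := skew M _ _ KM Kj Kk M_le0; have := skew N _ _ KN Kj Kk N_le0.
rewrite !le_eqVlt => /orP[/eqP N0|N_gt0] /orP[/eqP M0|M_gt0].
- by rewrite -N0 -M0.
- by rewrite (pos M N).
- by rewrite (pos N M).
- by rewrite (pos N M).
Qed.

Lemma word_mx_KK : generalized_cartan C -> symmetrizer C d ->
  is_KK_matrix C d CC (word_mx C w).
Proof.
move=> [C2 C_le0 _] [d_gt0 dC] j k Kj Kk.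
have horizontal := KK_horizontalP Kj Kk.
have jj := word_next_gt w j; have kk := word_next_gt w k.
have [hjk|/eqP hjk] := eqVneq (h j) (h k).
  have two : C (h j) (h k) = 2 by rewrite hjk C2.
  rewrite (@word_mx_same_letter _ w C _ _ Kj Kk hjk).
  rewrite (@word_mx_same_letter _ w C _ _ Kk Kj (esym hjk)) /=.
  split.
  - rewrite hjk; case: eqP => kE; case: eqP => jE;
      rewrite ?mulr0 ?oppr0 ?mulrN ?opprK//.
    by move: jj kk; rewrite -kE -jE !lte_fin; case: ltgtP.
  - case/horizontal => -[nE eE]; rewrite nE eqxx eE ?opprK //.
    by case: eqP => // kE; move: jj kk; rewrite -kE nE !lte_fin; case: ltgtP.
  - by case; rewrite two.
  - move=> pos; left; apply/horizontal; move: pos.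
    case: eqP => [kE|_]; last case: eqP => [jE|_]; rewrite ?ltxx//.
      by have [->|->] := chain_signP CC k; [right|].
    by have [->|->] := chain_signP CC j; [|left].
have inclP := KK_inclinedP Kj Kk hjk.
have C_le : C (h j) (h k) <= 0 by apply: C_le0; apply/eqP.
rewrite (@word_mx_inclined _ w C j k hjk).
rewrite (@word_mx_inclined _ w C k j (nesym hjk)) /=.
have asym : inclined w j k -> inclined w k j = false.
  by move=> /inclined_asym/negbTE.
split.
- case jk : (inclined w j k); first by rewrite asym// mulrN dC.
  by case: (inclined w k j); rewrite ?mulr0 ?oppr0// mulrN opprK dC.
- by case/horizontal => -[/word_next_letter/= hE _]; case: hjk.
- by case=> _ /inclP ->.
- case jk : (inclined w j k).
    by rewrite oppr_gt0 => C_lt; right; split=> //; apply/inclP.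
  by case: ifP => _; [rewrite ltNge C_le|rewrite ltxx].
Qed.

End Matrices.

Unset Implicit Arguments.
Set Strict Implicit.

(* The Kashiwara-Kim matrix is specified by is_KK_matrix; it exists, its index
   set of columns is the one of the signed word, and its entries with exchange
   column are those of the signed word. *)
Theorem proposition4p5 (I : finType) (C : I -> I -> int) (d : I -> int)
    (a b : \bar int) (i : int -> I) (CC : ibox_chain a b i)
    (hC : symmetrizable_gcm C) (hd : minimal_symmetrizer C d)
    (hrange : chain_range CC = Zitv a b)
    (hfin : locally_finite C (word_of_chain CC)) :
  [/\ exists M : int -> int -> int, is_KK_matrix C d CC M,
      chain_idx CC = word_idx (word_of_chain CC),
      chain_ex CC = word_ex (word_of_chain CC) &
      forall M : int -> int -> int, is_KK_matrix C d CC M ->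
        forall j k : int, chain_idx CC j -> chain_ex CC k ->
          M j k = word_mx C (word_of_chain CC) j k].
Proof.
have [[gcm _] [sym _]] := (hC, hd).
have KKw := @word_mx_KK I C d a b i CC gcm sym.
split=> //; first by exists (word_mx C (word_of_chain CC)).
- apply/seteqP; split=> s [Ks] /=.
    move=> nfr; split=> //; apply: contrapT => none; apply: nfr.
    by apply/chain_frozenP => // t Kt st ht; apply: none; exists t.
  move=> [t [Kt st ht]]; split=> // /(chain_frozenP hrange Ks).
  by move=> /(_ t Kt st); apply.
- by move=> M KM j k Kj [Kk _]; apply: (KK_matrix_unique sym.1 KM KKw).
Qed.
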